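(* Let $a,b,c$ be real numbers, let $\epsilon_{i,j}$, $i,j\in\mathbb{Z}$, be uncorrelated random variables with zero mean and equal variance $\sigma_\epsilon^2\in(0,\infty)$, and let $X=\{X_{i,j},\ i,j\in\mathbb{Z}\}$ be a wide-sense stationary field satisfying $$X_{i,j}=aX_{i-1,j}+bX_{i,j-1}+cX_{i-1,j-1}+\epsilon_{i,j}\qquad\text{for all } i,j\in\mathbb{Z}.$$ Put $D=(1-a-b-c)(1-a+b+c)(1+a-b+c)(1+a+b-c)$ (which is necessarily positive). Then for all integers $h_1,h_2$ $$\gamma_X(0,h_2)=\frac{\beta^{|h_2|}\sigma_\epsilon^2}{\sqrt{D}},\qquad \gamma_X(h_1,0)=\frac{\alpha^{|h_1|}\sigma_\epsilon^2}{\sqrt{D}},$$ where $$\alpha=\frac{2(a+bc)}{1+a^2-b^2-c^2+\operatorname{sign}(1+a^2-b^2-c^2)\sqrt{D}},\qquad \beta=\frac{2(ac+b)}{1-a^2+b^2-c^2+\operatorname{sign}(1-a^2+b^2-c^2)\sqrt{D}}.$$ In particular, $\operatorname{var}X_{i,j}=\gamma_X(0,0)=\sigma_\epsilon^2/\sqrt{D}$.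
   Context: All random variables are real-valued. A random field is wide-sense stationary if it has finite second moments, constant mean, and $\operatorname{cov}(X_{i,j},X_{i-h_1,j-h_2})$ depends only on $(h_1,h_2)$; its autocovariance function is $\gamma_X(h_1,h_2)=\operatorname{cov}(X_{i,j},X_{i-h_1,j-h_2})$. Here $\operatorname{sign}(x)=1$ for $x>0$ and $-1$ for $x<0$, and $0^0=1$. *)

(* Defs.v *)
From HB Require Import structures.
From mathcomp Require Import all_boot all_order all_algebra.
From mathcomp Require Import all_classical all_reals all_analysis.

Set Implicit Arguments.
Unset Strict Implicit.
Unset Printing Implicit Defensive.

Import Order.TTheory GRing.Theory Num.Theory.
Import numFieldNormedType.Exports.

Local Open Scope ring_scope.

Section random_fields.
Context (d : measure_display) (T : measurableType d) (R : realType)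
  (P : probability T R).

(* Uncorrelated square-integrable variables with mean 0 and variance s2. The
   library's covariance is extended-real valued, hence the %:E. *)
Definition white_noise (s2 : R) (eps : int -> int -> {RV P >-> R}) : Prop :=
  [/\ forall i j, (eps i j : T -> R) \in Lfun P 2%:E,
      forall i j, ('E_P[eps i j] = 0)%E,
      forall i j, ('V_P[eps i j] = s2%:E)%E &
      forall i j k l, (i, j) <> (k, l) ->
        covariance P (eps i j) (eps k l) = 0%E].

Definition wide_sense_stationary (X : int -> int -> {RV P >-> R}) : Prop :=
  [/\ forall i j, (X i j : T -> R) \in Lfun P 2%:E,
      exists m : \bar R, forall i j, ('E_P[X i j] = m)%E &
      forall h1 h2 : int, exists g : \bar R, forall i j : int,
        covariance P (X i j) (X (i - h1) (j - h2)) = g].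

(* The autocovariance function is evaluated at the base point (0, 0); for a
   wide-sense stationary field the choice of base point is immaterial. *)
Definition autocovariance (X : int -> int -> {RV P >-> R}) (h1 h2 : int)
    : \bar R :=
  covariance P (X 0 0) (X (0 - h1) (0 - h2)).

(* Equality of random variables is almost sure. *)
Definition spatial_autoregression (a b c : R)
    (X eps : int -> int -> {RV P >-> R}) : Prop :=
  forall i j : int, {ae P, forall w,
    X i j w = a * X (i - 1) j w + b * X i (j - 1) w
              + c * X (i - 1) (j - 1) w + eps i j w}.

End random_fields.

Section coefficients.
Context (R : realType).
Implicit Types a b c : R.

Definition sar_disc a b c : R :=
  (1 - a - b - c) * (1 - a + b + c) * (1 + a - b + c) * (1 + a + b - c).

(* Num.sg 0 = 0, but the argument of the sign is nonzero in both formulas as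
   soon as sar_disc a b c > 0: sar_disc a b c is equal both to
   (1 + a^2 - b^2 - c^2)^2 - 4 (a + b c)^2 and to
   (1 - a^2 + b^2 - c^2)^2 - 4 (a c + b)^2. *)
Definition sar_alpha a b c : R :=
  2 * (a + b * c) /
  (1 + a ^+ 2 - b ^+ 2 - c ^+ 2
   + Num.sg (1 + a ^+ 2 - b ^+ 2 - c ^+ 2) * Num.sqrt (sar_disc a b c)).

Definition sar_beta a b c : R :=
  2 * (a * c + b) /
  (1 - a ^+ 2 + b ^+ 2 - c ^+ 2
   + Num.sg (1 - a ^+ 2 + b ^+ 2 - c ^+ 2) * Num.sqrt (sar_disc a b c)).

End coefficients.

(* Main.v *)
(** Let r be the autocovariance of X and g (h, k) = cov (X_{i+h,j+k}, eps_{i,j}).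
With S1, S2 the unit shifts and Phi = 1 - a S1 - b S2 - c S1 S2, the model gives
Phi(S^-1) r = g and Phi(S) g = s2 delta, and Bessel's inequality makes g square
summable on Z^2. No causality is available, so everything is read off from these
three facts. If D <= 0, then Phi has a zero on the torus; pairing Phi(S) g with
the corresponding character over the square of side M and summing by parts shows
that the sum of g^2 along the boundary of the square is at least of order 1/M,
so that its sum over M would diverge. If D > 0, put p = 1 - b S2, q = a + c S2;
then |p|^2 - |q|^2 has constant sign on the circle and an energy estimate shows
that g vanishes on a half-plane (h < 0 or h >= 0 according to the sign).
Eliminating r (1, .) yields (p p* - q q* ) r (0, .) = +- s2 delta, a three-term
recurrence whose only bounded solution is the geometric one. *)

Require Import Defs.
From HB Require Import structures.
From mathcomp Require Import all_boot all_order all_algebra.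
From mathcomp Require Import all_classical all_reals all_analysis.
From mathcomp Require Import ring lra zify.

Set Implicit Arguments.
Unset Strict Implicit.
Unset Printing Implicit Defensive.

Import Order.TTheory GRing.Theory Num.Theory.
Import numFieldNormedType.Exports.

Local Open Scope ring_scope.

(** * Finite sums over integer intervals *)

Definition isum (R : realType) (lo : int) (n : nat) (f : int -> R) : R :=
  \sum_(i < n) f (lo + i%:Z).

Lemma isum_cat (R : realType) lo n1 n2 (f : int -> R) :
  isum lo (n1 + n2) f = isum lo n1 f + isum (lo + n1%:Z) n2 f.
Proof.
rewrite /isum big_split_ord /=; congr (_ + _).
by apply: eq_bigr => i _; rewrite PoszD addrA.
Qed.

Lemma isum_ge0 (R : realType) lo n (f : int -> R) :
  (forall i, 0 <= f i) -> 0 <= isum lo n f.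
Proof. by move=> f0; apply: sumr_ge0. Qed.

Lemma isum_subrange (R : realType) lo n lo' n' (f : int -> R) :
  (forall i, 0 <= f i) -> lo <= lo' -> lo' + n'%:Z <= lo + n%:Z ->
  isum lo' n' f <= isum lo n f.
Proof.
move=> f0 h1 h2.
have [m1 e1] : exists m1 : nat, lo' = lo + m1%:Z by exists `|lo' - lo|%N; lia.
have [m2 e2] : exists m2, n = (m1 + n' + m2)%N.
  by exists (n - (m1 + n'))%N; lia.
rewrite e2 e1 !isum_cat.
have := isum_ge0 lo m1 f0; have := isum_ge0 (lo + (m1 + n')%N) m2 f0.
by lra.
Qed.

Lemma isum_shift (R : realType) lo n d (f : int -> R) :
  isum lo n (fun i => f (i + d)) = isum (lo + d) n f.
Proof. by apply: eq_bigr => i _; rewrite addrAC. Qed.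

Lemma isumD (R : realType) lo n (f g : int -> R) :
  isum lo n (fun i => f i + g i) = isum lo n f + isum lo n g.
Proof. exact: big_split. Qed.

Lemma isumZ (R : realType) lo n a (f : int -> R) :
  isum lo n (fun i => a * f i) = a * isum lo n f.
Proof. by rewrite /isum mulr_sumr. Qed.

Lemma isum_cst (R : realType) lo n (a : R) : isum lo n (fun=> a) = a * n%:R.
Proof. by rewrite /isum sumr_const card_ord mulr_natr. Qed.

Lemma isum_le (R : realType) lo n (f g : int -> R) :
  (forall i, lo <= i < lo + n%:Z -> f i <= g i) -> isum lo n f <= isum lo n g.
Proof. by move=> fg; apply: ler_sum => i _; apply: fg; have := ltn_ord i; lia. Qed.

Lemma eq_isum (R : realType) lo n (f g : int -> R) :
  (forall i, f i = g i) -> isum lo n f = isum lo n g.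
Proof. by move=> fg; apply: eq_bigr. Qed.

Lemma isum_norm (R : realType) lo n (f : int -> R) :
  `|isum lo n f| <= isum lo n (fun i => `|f i|).
Proof. exact: ler_norm_sum. Qed.

Lemma isum_telescope (R : realType) lo n (f : int -> R) :
  isum lo n (fun i => f (i + 1) - f i) = f (lo + n%:Z) - f lo.
Proof.
elim: n => [|n IH]; first by rewrite /isum big_ord0 addr0 subrr.
have e : lo + n%:Z + 1 = lo + (n + 1)%N%:Z by lia.
by rewrite -addn1 isum_cat IH /isum big_ord1 addr0 e; ring.
Qed.

Lemma isum_exchange (R : realType) lo n lo' n' (f : int -> int -> R) :
  isum lo n (fun i => isum lo' n' (f i))
  = isum lo' n' (fun j => isum lo n (f^~ j)).
Proof. exact: exchange_big. Qed.

Lemma isum_delta (R : realType) lo n x (a : R) :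
  lo <= x < lo + n%:Z -> isum lo n (fun i => a * (i == x)%:R) = a.
Proof.
move=> lx; have lt : (`|x - lo| < n)%N by lia.
rewrite /isum (bigD1 (Ordinal lt)) //= big1 ?addr0.
  by rewrite (_ : (_ == _) = true) ?mulr1 //; apply/eqP; lia.
move=> i /eqP ne; rewrite (_ : (_ == _) = false) ?mulr0 //.
by apply/eqP => e; apply: ne; apply: val_inj => /=; lia.
Qed.

Lemma isum_ge_term (R : realType) lo n x (f : int -> R) :
  (forall i, 0 <= f i) -> lo <= x < lo + n%:Z -> f x <= isum lo n f.
Proof.
move=> f0 lx; rewrite -{1}(isum_delta (f x) lx).
apply: isum_le => i _; case: eqP => [->|_]; first by rewrite mulr1.
by rewrite mulr0.
Qed.

(** * Summable families on the lattice and their sums over square shells *)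

(** Meant for nonnegative [f], where it expresses summability with total at most [C]. Finite
    duplicate-free lists are used because Bessel's inequality yields its bounds in this form. *)
Definition sum_bounded (R : realType) (f : int -> int -> R) (C : R) : Prop :=
  forall s : seq (int * int), uniq s -> \sum_(x <- s) f x.1 x.2 <= C.

Lemma sum_bounded_comp (R : realType) (f : int -> int -> R) C
    (u : int * int -> int * int) : injective u ->
  sum_bounded f C -> sum_bounded (fun i j => f (u (i, j)).1 (u (i, j)).2) C.
Proof.
move=> ui fC s us; have := fC (map u s); rewrite map_inj_uniq // => /(_ us).
by rewrite big_map; apply: le_trans; apply: ler_sum => -[].
Qed.

(** Segments on distinct lines are disjoint, so together they form one duplicate-free list to which
    the bound [C] applies. *)
Lemma sum_bounded_lines (R : realType) (f : int -> int -> R) C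
    (line lo : nat -> int) (len : nat -> nat) n :
  injective line -> sum_bounded f C ->
  \sum_(m < n) isum (lo m) (len m) (f (line m)) <= C.
Proof.
move=> li fC.
pose s := [seq (line m, lo m + i%:Z) | m <- iota 0 n, i <- iota 0 (len m)].
have us : uniq s.
  apply: allpairs_uniq_dep; first exact: iota_uniq.
    by move=> ? _; exact: iota_uniq.
  move=> [m i] [m' i'] /= _ _ [/li e1 e2].
  by move: e2; rewrite e1 => /addrI [->].
apply: le_trans (fC s us).
rewrite /s big_allpairs_dep -(big_mkord xpredT
  (fun m => isum (lo m) (len m) (f (line m)))) /index_iota subn0.
apply: ler_sum => m _.
by rewrite /isum -(big_mkord xpredT (fun i => f (line m) (lo m + i%:Z)))
  /index_iota subn0.
Qed.

(* The lines on which the boundary terms of a summation by parts over the square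
   [-(m+1), m+1)^2 live. *)
Definition shell (R : realType) (f : int -> int -> R) (m : nat) : R :=
  isum (- m.+2%:Z) (m.+2).*2
    (fun j => f m j + f (- m.+2%:Z) j + (f j m + f j (- m.+2%:Z))).

(** Each of the four lines of a shell moves injectively with [m], so each of the four families
    contributes at most [C]; transposing [f] handles two of them. *)
Lemma sum_shell_bounded (R : realType) (f : int -> int -> R) C n :
  sum_bounded f C -> \sum_(m < n) shell f m <= 4 * C.
Proof.
move=> fC.
have fC' : sum_bounded (fun i j => f j i) C.
  by apply: (@sum_bounded_comp _ _ _ (fun x => (x.2, x.1))) fC => -[??] [??] [-> ->].
rewrite /shell; under eq_bigr do rewrite !isumD.
rewrite !big_split /=.
have i1 : injective Posz by move=> ? ? [].
have i2 : injective (fun m : nat => - m.+2%:Z) by move=> ? ?; lia.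
have := sum_bounded_lines (fun m => - m.+2%:Z) (fun m => (m.+2).*2) n i1 fC.
have := sum_bounded_lines (fun m => - m.+2%:Z) (fun m => (m.+2).*2) n i2 fC.
have := sum_bounded_lines (fun m => - m.+2%:Z) (fun m => (m.+2).*2) n i1 fC'.
have := sum_bounded_lines (fun m => - m.+2%:Z) (fun m => (m.+2).*2) n i2 fC'.
by lra.
Qed.

Lemma harmonic_unbounded (R : realType) (K : R) :
  exists n, K < \sum_(0 <= i < n) i.+1%:R^-1.
Proof.
apply: contrapT => noK; apply: (@dvg_harmonic R).
apply: nondecreasing_is_cvgn.
  by apply: nondecreasing_series => n _ _; exact: harmonic_ge0.
exists K => _ [n _ <-]; rewrite leNgt; apply/negP => ltK.
by apply: noK; exists n.
Qed.

(* Otherwise the shells would dominate a multiple of the harmonic series. *)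
Lemma shell_small (R : realType) (f : int -> int -> R) C (kappa : R) N :
  (forall i j, 0 <= f i j) -> sum_bounded f C -> 0 < kappa ->
  exists2 m, (N <= m)%N & m.+1%:R * shell f m < kappa.
Proof.
move=> f0 fC k0; apply: contrapT => no.
have big m : (N <= m)%N -> kappa * m.+1%:R^-1 <= shell f m.
  move=> Nm; rewrite ler_pdivrMr // mulrC leNgt; apply/negP => lt.
  by apply: no; exists m.
have sh0 m : 0 <= shell f m by apply: isum_ge0 => i; rewrite !addr_ge0.
(* The terms of index below [N] total at most [kappa * N], the others at most the total [4 * C] of
   the shells; the harmonic sum is taken beyond both. *)
have [n] := harmonic_unbounded ((kappa * N%:R + 4 * C) / kappa).
rewrite ltr_pdivrMr // [ltRHS]mulrC mulr_sumr; apply/negP; rewrite -leNgt.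
have sC := sum_shell_bounded n fC.
apply: (@le_trans _ _ (\sum_(0 <= i < n) (kappa * (i < N)%:R + shell f i))).
  apply: ler_sum => m _; case: (ltnP m N) => [lt|Nm] /=.
    rewrite mulr1 ler_wpDr // ler_piMr ?(ltW k0) // invf_le1 // ler1n //.
  by rewrite mulr0 add0r; exact: big.
rewrite big_split /= lerD //; last by rewrite big_mkord.
rewrite -mulr_sumr ler_pM2l // -natr_sum ler_nat.
suff -> : (\sum_(0 <= i < n) (i < N) = minn n N)%N by rewrite geq_minr.
elim: n {sC} => [|n IH]; first by rewrite big_geq // min0n.
by rewrite big_nat_recr //= IH; case: ltnP; lia.
Qed.

Lemma shell_lines (R : realType) (f : int -> int -> R) m :
  shell f m = isum (- m.+2%:Z) (m.+2).*2 (fun j => f m j)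
    + isum (- m.+2%:Z) (m.+2).*2 (fun j => f (- m.+2%:Z) j)
    + (isum (- m.+2%:Z) (m.+2).*2 (fun j => f j m)
       + isum (- m.+2%:Z) (m.+2).*2 (fun j => f j (- m.+2%:Z))).
Proof. by rewrite /shell !isumD. Qed.

(** Weighted inequality of arithmetic and geometric means on each term. The constant part [e / M] is
    summed over four lines of length at most [4 * M], which gives [16 * e]. *)
Lemma shell_abs_le (R : realType) (g : int -> int -> R) m (e : R) : 0 < e ->
  shell (fun i j => `|g i j|) m
    <= 16 * e + m.+1%:R * shell (fun i j => g i j ^+ 2) m / (4 * e).
Proof.
move=> e0; set M : R := m.+1%:R.
have M0 : 0 < M by rewrite ltr0n.
have amgm (x : R) : `|x| <= e / M + M / (4 * e) * x ^+ 2.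
  rewrite -real_normK ?num_real // -subr_ge0.
  rewrite (_ : _ - _ = (e - M * `|x| / 2) ^+ 2 / (M * e)); last first.
    by field; rewrite !gt_eqF.
  by rewrite divr_ge0 ?sqr_ge0 // mulr_ge0 // ltW.
pose l := M / (4 * e).
apply: (@le_trans _ _ (isum (- m.+2%:Z) (m.+2).*2 (fun=> 4 * (e / M))
    + l * shell (fun i j => g i j ^+ 2) m)).
  rewrite /shell -isumZ -isumD; apply: isum_le => j _.
  rewrite -/l in amgm *; move: (e / M) (l) amgm => u v amgm.
  have := amgm (g m j); have := amgm (g (- m.+2%:Z) j).
  have := amgm (g j m); have := amgm (g j (- m.+2%:Z)).
  by rewrite !mulrDr /=; lra.
rewrite isum_cst lerD //; last by rewrite /l [leLHS]mulrAC.
have le4 : (m.+2).*2%:R <= 4 * M.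
  by rewrite /M -natrM ler_nat; lia.
apply: (@le_trans _ _ (4 * (e / M) * (4 * M))).
  by rewrite ler_wpM2l // mulr_ge0 // divr_ge0 // ltW.
by rewrite le_eqVlt; apply/orP; left; apply/eqP; field; rewrite gt_eqF.
Qed.

(* Summation by parts over a square leaves a boundary term bounded by the sum of
   |g| over a shell, which a square summable g makes arbitrarily small for
   suitable squares. *)
Lemma no_bounded_adjoint_solution (R : realType) (a b c s C : R)
    (g phi : int -> int -> R) :
  0 < s -> sum_bounded (fun i j => g i j ^+ 2) C ->
  (forall h k, g h k - a * g (h - 1) k - b * g h (k - 1)
     - c * g (h - 1) (k - 1) = s * ((h == 0) && (k == 0))%:R) ->
  (forall h k, phi h k = a * phi (h + 1) k + b * phi h (k + 1)
     + c * phi (h + 1) (k + 1)) ->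
  (forall h k, `|phi h k| <= 1) -> phi 0 0 = 1 -> False.
Proof.
move=> s0 gC eqg eqphi phi1 phi00.
pose K := `|a| + `|b| + 2 * `|c| + 1.
have K0 : 0 < K.
  by have := normr_ge0 a; have := normr_ge0 b; have := normr_ge0 c; rewrite /K; lra.
(* With the threshold [e * s / K] below, both terms of [shell_abs_le] are at most [s / (4 * K)], so
   the boundary term is at most [s / 2]. *)
pose e := s / (64 * K).
have e0 : 0 < e by rewrite divr_gt0 // mulr_gt0.
have k0 : 0 < e * s / K by rewrite divr_gt0 // mulr_gt0.
have [|m _ sm] := shell_small 0%N _ gC k0; first by move=> i j; exact: sqr_ge0.
pose M : int := m.+1%:Z; pose n := (m.+1).*2.
(* [U] and [V] are the fluxes in the two directions: [phi] times the left side of the equation for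
   [g] is their discrete divergence. The diagonal shift carrying [c] is split into a step in [h] and
   a step in [k]. *)
pose U h k := (a * phi h k + c * phi h (k + 1)) * g (h - 1) k.
pose V h k := phi h k * (b * g h (k - 1) + c * g (h - 1) (k - 1)).
have div h k : (s * (h == 0)%:R) * (k == 0)%:R
    = (U (h + 1) k - U h k) + (V h (k + 1) - V h k).
  transitivity (phi h k * (s * ((h == 0) && (k == 0))%:R)).
    have [->|_] := eqVneq h 0; have [->|_] := eqVneq k 0;
      by rewrite ?phi00 /= ?(mulr0, mulr1, mul1r, mul0r).
  rewrite -eqg /U /V !addrK.
  have := eqphi h k => e1.
  rewrite mulrBr mulrBr mulrBr {1}e1.
  by ring.
have sE : s = isum (- M) n (fun k => U M k - U (- M) k)
            + isum (- M) n (fun h => V h M - V h (- M)).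
  transitivity (isum (- M) n (fun h => isum (- M) n
      (fun k => (s * (h == 0)%:R) * (k == 0)%:R))).
    transitivity (isum (- M) n (fun h => s * (h == 0)%:R)).
      by rewrite isum_delta // /M /n; lia.
    by apply: eq_isum => h; rewrite isum_delta // /M /n; lia.
  under eq_isum do under eq_isum do rewrite div.
  under eq_isum do rewrite isumD.
  rewrite isumD isum_exchange; congr (_ + _); apply: eq_isum => i.
    by rewrite (isum_telescope _ _ (U^~ i)); congr (U _ _ - _); rewrite /M /n; lia.
  by rewrite (isum_telescope _ _ (V i)); congr (V _ _ - _); rewrite /M /n; lia.
have Ule h k : `|U h k| <= (`|a| + `|c|) * `|g (h - 1) k|.
  rewrite normrM ler_wpM2r //; apply: le_trans (ler_normD _ _) _.
  by rewrite !normrM lerD // ler_piMr.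
have Vle h k : `|V h k| <= `|b| * `|g h (k - 1)| + `|c| * `|g (h - 1) (k - 1)|.
  rewrite normrM; apply: le_trans (ler_piMl _ (phi1 _ _)) _ => //.
  by apply: le_trans (ler_normD _ _) _; rewrite !normrM.
have M1 : M - 1 = m by rewrite /M; lia.
have M2 : - M - 1 = - m.+2%:Z by rewrite /M; lia.
have sub (f : int -> R) : (forall i, 0 <= f i) ->
    isum (- M) n f <= isum (- m.+2%:Z) (m.+2).*2 f /\
    isum (- M) n (fun i => f (i - 1)) <= isum (- m.+2%:Z) (m.+2).*2 f.
  by move=> f0; rewrite isum_shift; split; apply: isum_subrange => //;
    rewrite /M /n; lia.
pose G i j := `|g i j|.
have bound : s <= (K - 1) * shell G m.
  rewrite {1}sE -[leLHS]ger0_norm; last by rewrite -sE ltW.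
  apply: le_trans (ler_normD _ _) _.
  apply: (@le_trans _ _ (isum (- M) n (fun k => (`|a| + `|c|) * (G m k + G (- m.+2%:Z) k))
    + isum (- M) n (fun h => `|b| * (G h m + G h (- m.+2%:Z))
        + `|c| * (G (h - 1) m + G (h - 1) (- m.+2%:Z))))).
    apply: lerD; apply: le_trans (isum_norm _ _ _) _; apply: isum_le => i _.
      apply: le_trans (ler_normB _ _) _.
      by have := Ule M i; have := Ule (- M) i; rewrite M1 M2 /G; lra.
    apply: le_trans (ler_normB _ _) _.
    by have := Vle i M; have := Vle i (- M); rewrite M1 M2 /G; lra.
  rewrite shell_lines isumD !isumZ !isumD.
  have Gf i : forall j, 0 <= G i j by move=> j; exact: normr_ge0.
  have Gf' i : forall j, 0 <= G j i by move=> j; exact: normr_ge0.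
  have [A1 _] := sub (G m) (Gf m).
  have [A2 _] := sub (G (- m.+2%:Z)) (Gf _).
  have [A3 A3'] := sub (G^~ m) (Gf' m).
  have [A4 A4'] := sub (G^~ (- m.+2%:Z)) (Gf' _).
  have := isum_ge0 (- m.+2%:Z) (m.+2).*2 (Gf m).
  have := isum_ge0 (- m.+2%:Z) (m.+2).*2 (Gf (- m.+2%:Z)).
  have := isum_ge0 (- m.+2%:Z) (m.+2).*2 (Gf' m).
  have := isum_ge0 (- m.+2%:Z) (m.+2).*2 (Gf' (- m.+2%:Z)).
  move: A1 A2 A3 A3' A4 A4'.
  rewrite /K /=.
  set s1 := isum _ _ _; set s2 := isum _ _ _; set s3 := isum _ _ _.
  set s4 := isum _ _ _; set s5 := isum _ _ _; set s6 := isum _ _ _.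
  set s7 := isum _ _ _; set s8 := isum _ _ _.
  set s9 := isum _ _ _; set s10 := isum _ _ _.
  move=> A1 A2 A3 A3' A4 A4' B4 B3 B2 B1.
  have a0 := normr_ge0 a; have b0 := normr_ge0 b; have c0 := normr_ge0 c.
  have ac0 : 0 <= `|a| + `|c| by rewrite addr_ge0.
  have := ler_wpM2l ac0 (lerD A1 A2).
  have := ler_wpM2l b0 (lerD A3 A4).
  have := ler_wpM2l c0 (lerD A3' A4').
  have := mulr_ge0 b0 (addr_ge0 B1 B2).
  have := mulr_ge0 c0 (addr_ge0 B1 B2).
  have := mulr_ge0 a0 (addr_ge0 B3 B4).
  have := mulr_ge0 c0 (addr_ge0 B3 B4).
  by lra.
have := shell_abs_le g m e0; rewrite -/G => shG.
have shG2 : shell G m <= s / (2 * K).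
  apply: le_trans shG _.
  apply: (@le_trans _ _ (16 * e + e * s / K / (4 * e))).
    by rewrite lerD2l ler_wpM2r ?(ltW sm) // invr_ge0 mulr_ge0 // ltW.
  rewrite le_eqVlt; apply/orP; left; apply/eqP.
  rewrite {1}/e; field; rewrite !gt_eqF //.
have shG0 : 0 <= shell G m by apply: isum_ge0 => i; rewrite !addr_ge0 // normr_ge0.
have : s <= K * (s / (2 * K)).
  apply: le_trans bound _; apply: (@le_trans _ _ (K * shell G m)).
    by rewrite ler_wpM2r //; lra.
  by rewrite ler_pM2l.
rewrite (_ : K * _ = s / 2); last by field; rewrite gt_eqF.
by lra.
Qed.

(** * Positivity of the discriminant *)

Lemma unit_circle_angle (R : realType) (x y : R) : x ^+ 2 + y ^+ 2 = 1 ->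
  exists t, cos t = x /\ sin t = y.
Proof.
move=> xy1; have y2 : y ^+ 2 = 1 - x ^+ 2 by lra.
have x1 : x \in `[(-1), 1].
  rewrite in_itv /= -ler_norml -(@expr_le1 _ 2) // real_normK ?num_real //.
  by have := sqr_ge0 y; lra.
have cx := acosK x1; have sx : sin (acos x) = `|y|.
  by rewrite sin_acos ?y2 // -?y2 ?sqrtr_sqr //; move: x1; rewrite in_itv.
case: (lerP 0 y) => y0.
  by exists (acos x); rewrite cx sx ger0_norm.
by exists (- acos x); rewrite cosN sinN cx sx ltr0_norm // opprK.
Qed.

(** With z on the unit circle, p = 1 - b z and q = a + c z, a second unit number w with p = w q
    exists iff |p| = |q|. Here |p|^2 - |q|^2 = A - 2 B cos u, which vanishes for some u because D =
    A^2 - 4 B^2 is at most 0. *)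
Lemma symbol_zero_on_torus (R : realType) (a b c : R) : sar_disc a b c <= 0 ->
  exists t u : R, 1 = a * cos t + b * cos u + c * cos (t + u) /\
    0 = a * sin t + b * sin u + c * sin (t + u).
Proof.
pose A := 1 - a ^+ 2 + b ^+ 2 - c ^+ 2; pose B := a * c + b.
have -> : sar_disc a b c = A ^+ 2 - 4 * B ^+ 2 by rewrite /sar_disc /A /B; ring.
move=> D0.
have [x [x2 AB]] : exists x, x ^+ 2 <= 1 /\ A = 2 * B * x.
  have [B0|B0] := eqVneq B 0.
    exists 1; rewrite expr1n mulr1 B0 mulr0; split => //.
    apply/eqP; rewrite -sqrf_eq0 eq_le sqr_ge0 andbT.
    by move: D0; rewrite B0; lra.
  exists (A / (2 * B)); split; last by field.
  rewrite expr_div_n ler_pdivrMr ?exprn_even_gt0 ?mulf_neq0 //.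
  by rewrite mul1r exprMn; lra.
pose y := Num.sqrt (1 - x ^+ 2).
have xy : x ^+ 2 + y ^+ 2 = 1 by rewrite sqr_sqrtr; lra.
have [u [cu su]] := unit_circle_angle xy.
pose p1 := 1 - b * x; pose p2 := - (b * y).
pose q1 := a + c * x; pose q2 := c * y.
have pq : p1 ^+ 2 + p2 ^+ 2 = q1 ^+ 2 + q2 ^+ 2.
  apply/eqP; rewrite -subr_eq0; apply/eqP.
  transitivity (A - 2 * B * x + (b ^+ 2 - c ^+ 2) * (x ^+ 2 + y ^+ 2 - 1)).
    by rewrite /p1 /p2 /q1 /q2 /A /B; ring.
  by rewrite xy AB; ring.
(* The unit number v + i w is the quotient p / q; if q = 0 then p = 0 as well and any unit number
   serves. *)
have [v [w [vw e1 e2]]] : exists v w, [/\ v ^+ 2 + w ^+ 2 = 1,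
    p1 = v * q1 - w * q2 & p2 = v * q2 + w * q1].
  pose N := q1 ^+ 2 + q2 ^+ 2.
  have [N0|N0] := eqVneq N 0.
    have [q10 q20] : q1 = 0 /\ q2 = 0.
      move/eqP: N0; rewrite paddr_eq0 ?sqr_ge0 // !sqrf_eq0.
      by case/andP => /eqP -> /eqP ->.
    have [p10 p20] : p1 = 0 /\ p2 = 0.
      move/eqP: N0; rewrite /N -pq paddr_eq0 ?sqr_ge0 // !sqrf_eq0.
      by case/andP => /eqP -> /eqP ->.
    by exists 1, 0; rewrite p10 p20 q10 q20; split; ring.
  exists ((p1 * q1 + p2 * q2) / N), ((p2 * q1 - p1 * q2) / N); split.
  - transitivity ((p1 ^+ 2 + p2 ^+ 2) * N / N ^+ 2); first by rewrite /N; field.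
    by rewrite pq -/N; field.
  - by rewrite /N; field.
  - by rewrite /N; field.
have [t [ct st]] := unit_circle_angle vw.
exists t, u; rewrite cosD sinD ct st cu su.
by move: e1 e2; rewrite /p1 /p2 /q1 /q2; split; lra.
Qed.

(** A zero (t, u) of the symbol makes the real part of the character, cos (h t + k u), a bounded
    solution of the adjoint equation with value 1 at the origin. *)
Lemma sar_disc_gt0 (R : realType) (a b c s C : R) (g : int -> int -> R) :
  0 < s -> sum_bounded (fun i j => g i j ^+ 2) C ->
  (forall h k, g h k - a * g (h - 1) k - b * g h (k - 1)
     - c * g (h - 1) (k - 1) = s * ((h == 0) && (k == 0))%:R) ->
  0 < sar_disc a b c.
Proof.
move=> s0 gC eqg; rewrite ltNge; apply/negP => /symbol_zero_on_torus.
move=> [t [u [e1 e2]]].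
apply: (no_bounded_adjoint_solution
  (phi := fun h k => cos (h%:~R * t + k%:~R * u)) s0 gC eqg).
- move=> h k; rewrite !intrD !mulrDl !mul1r.
  set z := _ + _.
  have -> : h%:~R * t + t + k%:~R * u = z + t by rewrite /z; ring.
  have -> : h%:~R * t + (k%:~R * u + u) = z + u by rewrite /z; ring.
  have -> : h%:~R * t + t + (k%:~R * u + u) = z + (t + u) by rewrite /z; ring.
  rewrite (cosD z t) (cosD z u) (cosD z (t + u)).
  transitivity (cos z * (a * cos t + b * cos u + c * cos (t + u))
      - sin z * (a * sin t + b * sin u + c * sin (t + u))); last by ring.
  by rewrite -e1 -e2; ring.
- by move=> h k; exact: cos_max.
- by rewrite !mul0r addr0 cos0.
Qed.

(** * Vanishing on a half-plane by an energy estimate *)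

(** Put p = p0 + p1 S and q = q0 + q1 S, with S the unit shift in [k]. The first hypothesis says |p|
    > |q| on the unit circle, and the equation reads p g_h = q g_(h+1). Hence the energy of q g_h
    increases with h by at least a multiple of that of g_h, up to boundary terms, which summability
    makes small. *)
Lemma half_plane_uniqueness (R : realType) (p0 p1 q0 q1 C : R)
    (g : int -> int -> R) :
  2 * `|p0 * p1 - q0 * q1| < p0 ^+ 2 + p1 ^+ 2 - q0 ^+ 2 - q1 ^+ 2 ->
  sum_bounded (fun i j => g i j ^+ 2) C ->
  (forall h k, 1 <= h -> p0 * g h k + p1 * g h (k - 1)
     = q0 * g (h + 1) k + q1 * g (h + 1) (k - 1)) ->
  forall h k, 1 <= h -> g h k = 0.
Proof.
move=> dom gC eqg h0 k0 h01; apply/eqP; apply: contraT => gne.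
pose B := p0 * p1 - q0 * q1.
pose t := p0 ^+ 2 - q0 ^+ 2 - `|B|.
pose d := p0 ^+ 2 + p1 ^+ 2 - q0 ^+ 2 - q1 ^+ 2 - 2 * `|B|.
have d0 : 0 < d by rewrite /d /B subr_gt0.
pose K := 2 * q0 ^+ 2 + 2 * q1 ^+ 2 + `|t| + 1.
have K0 : 0 < K.
  by have := sqr_ge0 q0; have := sqr_ge0 q1; have := normr_ge0 t; rewrite /K; lra.
pose Q h k := (q0 * g h k + q1 * g h (k - 1)) ^+ 2.
have g2 i j : 0 <= g i j ^+ 2 by exact: sqr_ge0.
(* The cross term of |p g|^2 - |q g|^2 is absorbed by [|B|] times the two squares. The remaining
   weights [t] and [d - t] are unequal; the discrepancy telescopes in [k]. *)
have step h k : 1 <= h -> d * g h (k - 1) ^+ 2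
    <= (Q (h + 1) k - Q h k) + - t * (g h (k + 1 - 1) ^+ 2 - g h (k - 1) ^+ 2).
  move=> h1; rewrite addrK /Q -eqg //.
  have B1 : 0 <= `|B| + B by have := ler_norm (- B); rewrite normrN; lra.
  have B2 : 0 <= `|B| - B by have := ler_norm B; lra.
  have := mulr_ge0 B1 (sqr_ge0 (g h k + g h (k - 1))).
  have := mulr_ge0 B2 (sqr_ge0 (g h k - g h (k - 1))).
  rewrite /d /t; move: (`|B|) => nB; rewrite /B => h2 h3.
  by lra.
have k1 : 0 < d * g h0 k0 ^+ 2 / K.
  by rewrite !divr_gt0 // mulr_gt0 // exprn_even_gt0 //= gne.
(* The lower bound on [m] places [(h0, k0)] inside the rectangle summed over. *)
have [m Nm sm] := shell_small (`|h0| + `|k0| + 2)%N g2 gC k1.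
pose M : int := m.+1%:Z; pose n := (m.+1).*2.
have sh0 : 0 <= shell (fun i j => g i j ^+ 2) m.
  by apply: isum_ge0 => i; rewrite !addr_ge0.
suff : d * g h0 k0 ^+ 2 <= K * shell (fun i j => g i j ^+ 2) m.
  move: sm; rewrite ltr_pdivlMr // mulrC => sm le.
  have := le_lt_trans le (le_lt_trans _ sm); rewrite ltxx; apply.
  by rewrite ler_wpM2l ?(ltW K0) // ler_peMl // ler1n.
have subr (f : int -> R) : (forall i, 0 <= f i) ->
    isum (- M) n f <= isum (- m.+2%:Z) (m.+2).*2 f.
  by move=> f0; apply: isum_subrange => //; rewrite /M /n; lia.
have subr' (f : int -> R) : (forall i, 0 <= f i) ->
    isum (- M) n (fun k => f (k - 1)) <= isum (- m.+2%:Z) (m.+2).*2 f.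
  by move=> f0; rewrite isum_shift; apply: isum_subrange => //; rewrite /M /n; lia.
have subc (f : int -> R) : (forall i, 0 <= f i) ->
    isum 1 m.-1 f <= isum (- m.+2%:Z) (m.+2).*2 f.
  by move=> f0; apply: isum_subrange => //; lia.
apply: (@le_trans _ _ (isum 1 m.-1 (fun h => isum (- M) n
    (fun k => d * g h (k - 1) ^+ 2)))).
  have f0 h i : 0 <= d * g h i ^+ 2 by rewrite mulr_ge0 // ltW.
  apply: le_trans (isum_ge_term (f := fun h => isum (- M) n
    (fun k => d * g h (k - 1) ^+ 2)) (x := h0) _ _); last first.
  - by lia.
  - by move=> i; apply: isum_ge0.
  rewrite (isum_shift _ _ _ (fun k => d * g h0 k ^+ 2)).
  by apply: isum_ge_term => //; rewrite /M /n; lia.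
apply: (@le_trans _ _ (isum 1 m.-1 (fun h => isum (- M) n
    (fun k => (Q (h + 1) k - Q h k)
       + - t * (g h (k + 1 - 1) ^+ 2 - g h (k - 1) ^+ 2))))).
  by apply: isum_le => h h1; apply: isum_le => k _; apply: step; lia.
under eq_isum do rewrite isumD isumZ (isum_telescope _ _ (fun k => g _ (k - 1) ^+ 2)).
rewrite isumD isum_exchange isumZ.
under eq_isum do rewrite (isum_telescope _ _ (Q^~ _)).
have -> : 1 + m.-1%:Z = m by lia.
have -> : - M + n%:Z - 1 = m by rewrite /M /n; lia.
have -> : - M - 1 = - m.+2%:Z by rewrite /M; lia.
have dbl0 (x : R) : 0 <= 2 * x ^+ 2 by rewrite mulr_ge0 // sqr_ge0.
have QK : isum (- M) n (fun k => Q m k - Q 1 k)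
    <= (2 * q0 ^+ 2 + 2 * q1 ^+ 2) * isum (- m.+2%:Z) (m.+2).*2 (fun j => g m j ^+ 2).
  apply: (@le_trans _ _ (isum (- M) n (fun k => 2 * q0 ^+ 2 * g m k ^+ 2
      + 2 * q1 ^+ 2 * g m (k - 1) ^+ 2))).
    apply: isum_le => k _; have := sqr_ge0 (q0 * g 1 k + q1 * g 1 (k - 1)).
    have := sqr_ge0 (q0 * g m k - q1 * g m (k - 1)).
    by rewrite /Q; lra.
  rewrite isumD !isumZ [leRHS]mulrDl; apply: lerD.
    by rewrite ler_wpM2l //; apply: (subr (fun k => g m k ^+ 2)).
  by rewrite ler_wpM2l //; apply: (subr' (fun k => g m k ^+ 2)).
have tK : - t * isum 1 m.-1 (fun h => g h m ^+ 2 - g h (- m.+2%:Z) ^+ 2)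
    <= `|t| * (isum (- m.+2%:Z) (m.+2).*2 (fun j => g j m ^+ 2)
       + isum (- m.+2%:Z) (m.+2).*2 (fun j => g j (- m.+2%:Z) ^+ 2)).
  apply: le_trans (ler_norm _) _; rewrite normrM normrN ler_wpM2l //.
  apply: le_trans (isum_norm _ _ _) _.
  apply: (@le_trans _ _ (isum 1 m.-1 (fun h => g h m ^+ 2 + g h (- m.+2%:Z) ^+ 2))).
    apply: isum_le => h _; apply: le_trans (ler_normB _ _) _.
    by rewrite !ger0_norm.
  by rewrite isumD lerD //; apply: subc.
apply: le_trans (lerD QK tK) _.
move: sh0; rewrite shell_lines.
have := isum_ge0 (- m.+2%:Z) (m.+2).*2 (f := fun j => g m j ^+ 2).
have := isum_ge0 (- m.+2%:Z) (m.+2).*2 (f := fun j => g (- m.+2%:Z) j ^+ 2).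
have := isum_ge0 (- m.+2%:Z) (m.+2).*2 (f := fun j => g j m ^+ 2).
have := isum_ge0 (- m.+2%:Z) (m.+2).*2 (f := fun j => g j (- m.+2%:Z) ^+ 2).
set s1 := isum _ _ _; set s2 := isum _ _ _; set s3 := isum _ _ _.
set s4 := isum _ _ _.
move=> /(_ (fun=> g2 _ _)) H1 /(_ (fun=> g2 _ _)) H2 /(_ (fun=> g2 _ _)) H3.
move=> /(_ (fun=> g2 _ _)) H4 _.
rewrite /K; have := normr_ge0 t; move: (`|t|) => nt nt0.
have q02 : 0 <= 2 * q0 ^+ 2 + 2 * q1 ^+ 2 by rewrite addr_ge0.
move: (2 * q0 ^+ 2 + 2 * q1 ^+ 2) q02 => L L0.
have := mulr_ge0 L0 H1; have := mulr_ge0 L0 H2; have := mulr_ge0 L0 H3.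
have := mulr_ge0 nt0 H4; have := mulr_ge0 nt0 H3.
by lra.
Qed.

(** * The covariances along a row *)

(** This is D = A^2 - 4 B^2 > 0 after taking square roots; equivalently A - 2 B cos u keeps a
    constant sign. *)
Lemma sar_disc_lt (R : realType) (a b c : R) : 0 < sar_disc a b c ->
  2 * `|a * c + b| < `|1 - a ^+ 2 + b ^+ 2 - c ^+ 2|.
Proof.
move=> D0; rewrite -(@ltr_pXn2r _ 2) ?nnegrE ?mulr_ge0 //.
rewrite exprMn !real_normK ?num_real // -subr_gt0.
suff <- : sar_disc a b c = (1 - a ^+ 2 + b ^+ 2 - c ^+ 2) ^+ 2
  - 2 ^+ 2 * (a * c + b) ^+ 2 by [].
by rewrite /sar_disc; ring.
Qed.

(* If the coefficient of r 0 k is positive, g vanishes on the rows h < 0, and if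
   it is negative on the rows h >= 0; either way r 1 and r (-1) can be
   eliminated. *)
Lemma row_recurrence (R : realType) (a b c s C : R) (r g : int -> int -> R) :
  0 < sar_disc a b c -> sum_bounded (fun i j => g i j ^+ 2) C ->
  (forall h k, r (- h) (- k) = r h k) ->
  (forall h k, g h k = r h k - a * r (h + 1) k - b * r h (k + 1)
     - c * r (h + 1) (k + 1)) ->
  (forall h k, g h k - a * g (h - 1) k - b * g h (k - 1)
     - c * g (h - 1) (k - 1) = s * ((h == 0) && (k == 0))%:R) ->
  forall k, (1 - a ^+ 2 + b ^+ 2 - c ^+ 2) * r 0 k
      - (a * c + b) * (r 0 (k + 1) + r 0 (k - 1))
    = Num.sg (1 - a ^+ 2 + b ^+ 2 - c ^+ 2) * s * (k == 0)%:R.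
Proof.
move=> /sar_disc_lt; set A := 1 - _ + _ - _; set B := _ * _ + _.
move=> AB gC rN gE eqg k.
have r0N i : r 0 (- i) = r 0 i by rewrite -{1}oppr0 rN.
have e10 : (- 1 + 1 : int) = 0 by lia.
have e01 : (0 - 1 : int) = - 1 by lia.
case: (ltrgt0P A) => [A0|A0|A0]; last first.
- by move: AB; rewrite A0 normr0; have := normr_ge0 B; lra.
(* For [A < 0] the roles of p and q are exchanged, and the rows are shifted by one so that the
   sourceless equations start at 1. *)
- have gz i : g 0 i = 0.
    rewrite -[0](subrr (1 : int)).
    apply: (half_plane_uniqueness (p0 := a) (p1 := c) (q0 := 1) (q1 := - b)
      (g := fun h k => g (h - 1) k) (C := C)) => //.
    + rewrite (_ : _ - _ * _ = B); last by rewrite /B; ring.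
      by apply: lt_le_trans AB _; rewrite ltr0_norm // /A; lra.
    + apply: (@sum_bounded_comp _ _ _ (fun x => (x.1 - 1, x.2))) gC.
      by move=> [x1 x2] [y1 y2] [/addIr -> ->].
    + move=> h j h1; have := eqg h j; rewrite addrK.
      by rewrite (_ : (h == 0) = false) /=; [lra | lia].
  have F i : r 0 i - b * r 0 (i + 1) = a * r 1 i + c * r 1 (i + 1).
    by have := gE 0 i; rewrite gz add0r; lra.
  have r1N i : r 1 (- i) = r (- 1) i by rewrite -rN opprK.
  have F1 := F (- k); rewrite r0N r1N (_ : - k + 1 = - (k - 1)) in F1; last by lia.
  rewrite r0N r1N in F1.
  have F2 := F (- (k + 1)); rewrite r0N r1N (_ : - (k + 1) + 1 = - k) in F2; last by lia.
  rewrite r0N r1N in F2.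
  have := eqg 0 k; rewrite !gz e01 !gE e10 subrK eqxx /=.
  rewrite (ltr0_sg A0) /A /B; move: F1 F2 => /(congr1 ( *%R 1)) F1 /(congr1 ( *%R b)) F2.
  by lra.
(* For [A > 0] the rows are reflected, so the rows below the source become the half-plane. *)
- have gz i : g (- 1) i = 0.
    apply: (half_plane_uniqueness (p0 := 1) (p1 := - b) (q0 := a) (q1 := c)
      (g := fun h k => g (- h) k) (C := C)) => //.
    + rewrite (_ : _ - _ * _ = - B) ?normrN; last by rewrite /B; ring.
      by apply: lt_le_trans AB _; rewrite gtr0_norm // /A; lra.
    + apply: (@sum_bounded_comp _ _ _ (fun x => (- x.1, x.2))) gC.
      by move=> [x1 x2] [y1 y2] [/oppr_inj -> ->].
    + move=> h j h1; have := eqg (- h) j; rewrite opprD.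
      by rewrite (_ : (- h == 0) = false) /=; [lra | lia].
  have F i : r 1 i - b * r 1 (i - 1) = a * r 0 i + c * r 0 (i - 1).
    have := gE (- 1) (- i); rewrite gz e10 rN r0N (_ : - i + 1 = - (i - 1)); last by lia.
    by rewrite rN r0N; lra.
  have F1 := F k; have F2 := F (k + 1); rewrite addrK in F2.
  have := eqg 0 k; rewrite e01 !gz !gE add0r subrK eqxx /=.
  rewrite (gtr0_sg A0) /A /B.
  move: F1 F2 => /(congr1 ( *%R a)) F1 /(congr1 ( *%R c)) F2.
  by lra.
Qed.

(** Each use of the recurrence improves a uniform bound on [e] by the factor 2|B| / |A| < 1. *)
Lemma bounded_recurrence_eq0 (R : realType) (A B C : R) (e : int -> R) :
  2 * `|B| < `|A| -> (forall k, `|e k| <= C) ->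
  (forall k, A * e k = B * (e (k + 1) + e (k - 1))) -> forall k, e k = 0.
Proof.
move=> AB eC rec k; pose q := 2 * `|B| / `|A|.
have A0 : 0 < `|A| by apply: le_lt_trans AB; rewrite mulr_ge0.
have q0 : 0 <= q by rewrite divr_ge0 // mulr_ge0.
have q1 : q < 1 by rewrite ltr_pdivrMr // mul1r.
have bound n j : `|e j| <= C * q ^+ n.
  elim: n j => [|n IH] j; first by rewrite mulr1.
  rewrite exprS mulrCA /q mulrAC ler_pdivlMr // mulrC -normrM rec normrM.
  rewrite [leRHS](_ : _ = `|B| * (2 * (C * q ^+ n))); last by ring.
  rewrite ler_wpM2l //.
  by apply: le_trans (ler_normD _ _) _; have := IH (j + 1); have := IH (j - 1); lra.
apply/eqP; rewrite -normr_le0.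
have cv : ((fun n => C * q ^+ n) @ \oo --> C * 0)%classic.
  by apply: cvgMr; apply: cvg_expr; rewrite ger0_norm.
rewrite -(mulr0 C) -(cvg_lim _ cv) //; apply: limr_ge.
  by apply/cvg_ex; exists (C * 0).
by near=> n; exact: bound.
Unshelve. all: by end_near. Qed.

(** The two-sided geometric sequence solves the recurrence of [row_recurrence] with the same source,
    so its difference from [r 0] is a bounded homogeneous solution, hence zero. *)
Lemma row_closed_form (R : realType) (a b c s C K : R) (r g : int -> int -> R) :
  0 < s -> sum_bounded (fun i j => g i j ^+ 2) C ->
  (forall h k, `|r h k| <= K) -> (forall h k, r (- h) (- k) = r h k) ->
  (forall h k, g h k = r h k - a * r (h + 1) k - b * r h (k + 1)
     - c * r (h + 1) (k + 1)) ->
  (forall h k, g h k - a * g (h - 1) k - b * g h (k - 1)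
     - c * g (h - 1) (k - 1) = s * ((h == 0) && (k == 0))%:R) ->
  forall k, r 0 k = sar_beta a b c ^+ `|k|%N * s / Num.sqrt (sar_disc a b c).
Proof.
move=> s0 gC rK rN gE eqg k.
have D0 := sar_disc_gt0 s0 gC eqg.
have AB := sar_disc_lt D0.
have rec := row_recurrence D0 gC rN gE eqg.
pose w := Num.sqrt (sar_disc a b c).
have w0 : 0 < w by rewrite sqrtr_gt0.
have w2 : w ^+ 2 = (1 - a ^+ 2 + b ^+ 2 - c ^+ 2) ^+ 2 - 4 * (a * c + b) ^+ 2.
  by rewrite sqr_sqrtr ?ltW // /sar_disc; ring.
rewrite /sar_beta -/w; move: AB rec w2.
set A := 1 - _ + _ - _; set B := _ * _ + _ => AB rec w2.
pose sg := Num.sg A; pose den := A + sg * w; rewrite -/sg -/den.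
have A0 : 0 < `|A| by apply: le_lt_trans AB; rewrite mulr_ge0.
have An0 : A != 0 by rewrite -normr_gt0.
have sg2 : sg ^+ 2 = 1 by rewrite /sg sqr_sg An0.
(* The sign in the denominator rules out cancellation: [den] is nonzero, and |2 B| < |A| then puts
   [be] in the closed unit disc. *)
have denn : `|den| = `|A| + w.
  rewrite /den {1}(numEsg A) -/sg -mulrDr normrM /sg normr_sg An0 mul1r.
  by rewrite gtr0_norm // addr_gt0.
have den0 : den != 0 by rewrite -normr_gt0 denn addr_gt0.
pose be := 2 * B / den; rewrite -/be.
have be1 : `|be| <= 1.
  rewrite normrM normfV ler_pdivrMr ?normr_gt0 // mul1r normrM ger0_norm // denn.
  by rewrite ler_wpDr // ltW.
(* [E1] produces the source at [k = 0]; [E2] is the characteristic equation, which handles every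
   other [k]. *)
have E1 : A - 2 * B * be = sg * w.
  apply: (mulIf den0); rewrite /be mulrBl -[2 * B * (_ / _) * _]mulrA divfK //.
  rewrite /den; have -> : sg * w * (A + sg * w) = sg * w * A + sg ^+ 2 * w ^+ 2 by ring.
  by rewrite sg2 w2; ring.
have E2 : A * be = B * (be ^+ 2 + 1).
  apply: (mulIf (expf_neq0 2 den0)); rewrite /be.
  transitivity (A * (2 * B) * den); first by field.
  transitivity (B * ((2 * B) ^+ 2 + den ^+ 2)); last by field.
  have -> : den ^+ 2 = A ^+ 2 + 2 * A * sg * w + sg ^+ 2 * w ^+ 2.
    by rewrite /den; ring.
  by rewrite sg2 w2 /den; ring.
pose v (k : int) := be ^+ `|k|%N * s / w.
suff : r 0 k - v k = 0 by move/eqP; rewrite subr_eq0 => /eqP.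
apply: (bounded_recurrence_eq0 (C := K + s / w)
  (e := fun k => r 0 k - v k) AB) => {k} k.
  apply: le_trans (ler_normB _ _) _; apply: lerD => //.
  have sw0 := divr_gt0 s0 w0.
  rewrite /v -mulrA normrM (gtr0_norm sw0) ler_piMl ?(ltW sw0) //.
  by rewrite normrX exprn_ile1.
suff vrec : A * v k - B * (v (k + 1) + v (k - 1)) = sg * s * (k == 0)%:R.
  by have := rec k; rewrite -/sg; lra.
have pos n : A * v n.+1%:Z - B * (v n.+2%:Z + v n%:Z) = 0.
  rewrite /v /= !exprS; transitivity ((A * be - B * (be ^+ 2 + 1)) * (be ^+ n * s / w)).
    by ring.
  by rewrite E2 subrr mul0r.
have vN j : v (- j) = v j by rewrite /v abszN.
case: k => [[|n]|n] /=.
- rewrite add0r sub0r vN mulr1 /v absz0 absz1 expr0 expr1.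
  transitivity ((A - 2 * B * be) * (s / w)); first by ring.
  by rewrite E1; field; rewrite gt_eqF.
- have e1 : n.+1%:Z + 1 = n.+2%:Z by lia.
  have e2 : n.+1%:Z - 1 = n%:Z by lia.
  by rewrite mulr0 e1 e2 pos.
- have e1 : Negz n + 1 = - n%:Z by lia.
  have e2 : Negz n - 1 = - n.+2%:Z by lia.
  by rewrite mulr0 e1 e2 NegzE !vN [v n%:Z + _]addrC pos.
Qed.

(** * Covariances of square-integrable variables *)

(** Real-valued covariance. [fine] sends infinite values to 0, but by [rcovE] nothing is lost for
    square-integrable variables. *)
Definition rcov d (T : measurableType d) (R : realType) (P : probability T R)
  (X Y : T -> R) : R := fine (covariance P X Y).

Lemma Lfun2_Lfun1 d (T : measurableType d) (R : realType)
    (P : probability T R) (X : T -> R) :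
  X \in Lfun P 2%:E -> X \in Lfun P 1.
Proof. by apply: Lfun_subset12; exact: fin_num_measure. Qed.

Lemma rcovE d (T : measurableType d) (R : realType) (P : probability T R)
    (X Y : T -> R) : X \in Lfun P 2%:E -> Y \in Lfun P 2%:E ->
  covariance P X Y = (rcov P X Y)%:E.
Proof.
move=> X2 Y2; rewrite /rcov fineK //.
by apply: covariance_fin_num; [exact: Lfun2_Lfun1..|exact: Lfun2_mul_Lfun1].
Qed.

Lemma rcovC d (T : measurableType d) (R : realType) (P : probability T R)
    (X Y : T -> R) : rcov P X Y = rcov P Y X.
Proof. by rewrite /rcov covarianceC. Qed.

Lemma rcov_ge0 d (T : measurableType d) (R : realType) (P : probability T R)
    (X : T -> R) : 0 <= rcov P X X.
Proof. by rewrite fine_ge0 // variance_ge0. Qed.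

(** Iterating this single operation builds both the right side of the model equation and the
    residuals in Bessel's inequality. *)
Lemma Lfun2_addZ d (T : measurableType d) (R : realType) (P : probability T R)
    (X Y : T -> R) (a : R) : X \in Lfun P 2%:E -> Y \in Lfun P 2%:E ->
  (fun w => X w + a * Y w) \in Lfun P 2%:E.
Proof.
move=> X2 Y2; have -> : (fun w => X w + a * Y w) = (X + a \o* Y).
  by apply/funext => w /=; rewrite mulrC.
by apply: rpredD => //; [rewrite lee1n | move=> ?; apply: Lfun_scale; rewrite ?ler1n].
Qed.

Lemma rcov_addZl d (T : measurableType d) (R : realType) (P : probability T R)
    (X Y Z : T -> R) (a : R) :
  X \in Lfun P 2%:E -> Y \in Lfun P 2%:E -> Z \in Lfun P 2%:E ->
  rcov P (fun w => X w + a * Y w) Z = rcov P X Z + a * rcov P Y Z.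
Proof.
move=> X2 Y2 Z2; have -> : (fun w => X w + a * Y w) = (X \+ a \o* Y).
  by apply/funext => w /=; rewrite mulrC.
rewrite {1}/rcov covarianceDl //; last by apply: Lfun_scale; rewrite ?ler1n.
rewrite covarianceZl; [|exact: Lfun2_Lfun1..|exact: Lfun2_mul_Lfun1].
by rewrite !rcovE // -EFinM -EFinD.
Qed.

Lemma expectation_ae_eq d (T : measurableType d) (R : realType)
    (P : probability T R) (X Y : T -> R) : X \in Lfun P 1 -> Y \in Lfun P 1 ->
  {ae P, forall w, X w = Y w} -> ('E_P[X] = 'E_P[Y])%E.
Proof.
move=> /Lfun1_integrable/integrableP[mX _] /Lfun1_integrable/integrableP[mY _].
move=> XY; rewrite unlock; apply: ae_eq_integral => //.
by apply: filterS XY => w e _ /=; rewrite e.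
Qed.

(** Covariance is a combination of expectations, which ignore null sets; this lets the almost sure
    model equation enter covariances. *)
Lemma rcov_ae_eql d (T : measurableType d) (R : realType)
    (P : probability T R) (X Y Z : T -> R) :
  X \in Lfun P 2%:E -> Y \in Lfun P 2%:E -> Z \in Lfun P 2%:E ->
  {ae P, forall w, X w = Y w} -> rcov P X Z = rcov P Y Z.
Proof.
move=> X2 Y2 Z2 XY; rewrite /rcov; congr fine.
have XZ1 := Lfun2_mul_Lfun1 X2 Z2; have YZ1 := Lfun2_mul_Lfun1 Y2 Z2.
have X1 := Lfun2_Lfun1 X2; have Y1 := Lfun2_Lfun1 Y2; have Z1 := Lfun2_Lfun1 Z2.
rewrite !covarianceE // (expectation_ae_eq X1 Y1 XY).
rewrite (expectation_ae_eq XZ1 YZ1) //.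
by apply: filterS XY => w e; exact: (congr1 ( *%R^~ (Z w)) e).
Qed.

(** The variances of X + Y and X - Y are nonnegative. Under stationarity both variances on the right
    agree, so this gives the bound of Cauchy and Schwarz. *)
Lemma rcov_norm_le d (T : measurableType d) (R : realType)
    (P : probability T R) (X Y : T -> R) :
  X \in Lfun P 2%:E -> Y \in Lfun P 2%:E ->
  `|rcov P X Y| <= (rcov P X X + rcov P Y Y) / 2.
Proof.
move=> X2 Y2.
have ge a : 0 <= rcov P X X + a * rcov P X Y + a * (rcov P X Y + a * rcov P Y Y).
  have XY2 := Lfun2_addZ a X2 Y2.
  have := rcov_ge0 P (fun w => X w + a * Y w).
  rewrite rcov_addZl // (rcovC P X) (rcovC P Y (fun _ => _)) !rcov_addZl //.
  by rewrite (rcovC P Y X).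
have := ge 1; have := ge (- 1); rewrite ler_norml => *; apply/andP; split; lra.
Qed.

(** Projections are subtracted one at a time, each lowering [s2] times the variance by one square.
    The induction also records that covariances with the remaining [e j] are unchanged. *)
Lemma bessel_rcov d (T : measurableType d) (R : realType)
    (P : probability T R) (I : eqType) (e : I -> T -> R) (X : T -> R) (s2 : R) :
  0 < s2 -> X \in Lfun P 2%:E -> (forall i, e i \in Lfun P 2%:E) ->
  (forall i, rcov P (e i) (e i) = s2) ->
  (forall i j, i != j -> rcov P (e i) (e j) = 0) ->
  forall s : seq I, uniq s ->
  \sum_(i <- s) rcov P X (e i) ^+ 2 <= s2 * rcov P X X.
Proof.
move=> s0 X2 e2 ee eo s us.
(* the residual of X after projection onto the e i, i in s *)
suff [Y [Y2 _ YY]] : exists Y : T -> R, [/\ Y \in Lfun P 2%:E,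
    forall j, j \notin s -> rcov P Y (e j) = rcov P X (e j) &
    s2 * rcov P Y Y = s2 * rcov P X X - \sum_(i <- s) rcov P X (e i) ^+ 2].
  by rewrite -subr_ge0 -YY mulr_ge0 ?rcov_ge0 // ltW.
elim: s us => [_|i s IH /= /andP[nis /IH [Y [Y2 Yo YY]]]].
  by exists X; split => //; rewrite big_nil subr0.
pose a := - (rcov P X (e i) / s2).
have Z2 := Lfun2_addZ a Y2 (e2 i).
exists (fun w => Y w + a * e i w); split => // [j|].
  rewrite inE negb_or => /andP[ji js].
  by rewrite rcov_addZl // Yo // eo ?mulr0 ?addr0 // eq_sym.
rewrite rcov_addZl // (rcovC P Y (fun _ => _)) (rcovC P (e i) (fun _ => _)).
rewrite !rcov_addZl // (rcovC P (e i) Y) Yo // ee big_cons.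
have -> : \sum_(j <- s) rcov P X (e j) ^+ 2 = s2 * rcov P X X - s2 * rcov P Y Y.
  by rewrite YY; lra.
by rewrite /a; field; rewrite gt_eqF.
Qed.

(** * Exchange of the coordinates, covariance form of the model, and conclusion *)

Lemma sar_discC (R : realType) (a b c : R) : sar_disc b a c = sar_disc a b c.
Proof. by rewrite /sar_disc; ring. Qed.

(** Transposing the field swaps [a] and [b], so the formula along columns follows from the one along
    rows. *)
Lemma sar_betaC (R : realType) (a b c : R) :
  sar_beta b a c = sar_alpha a b c.
Proof.
rewrite /sar_beta /sar_alpha sar_discC.
have -> : 1 - b ^+ 2 + a ^+ 2 - c ^+ 2 = 1 + a ^+ 2 - b ^+ 2 - c ^+ 2 by ring.
by have -> : b * c + a = a + b * c by ring.
Qed.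

Lemma rcov_autoregression (d : measure_display) (T : measurableType d)
    (R : realType) (P : probability T R) (a b c : R)
    (X eps : int -> int -> {RV P >-> R}) (Z : T -> R) i j :
  (forall i j, (X i j : T -> R) \in Lfun P 2%:E) ->
  (forall i j, (eps i j : T -> R) \in Lfun P 2%:E) ->
  Z \in Lfun P 2%:E -> spatial_autoregression a b c X eps ->
  rcov P (X i j) Z = a * rcov P (X (i - 1) j) Z + b * rcov P (X i (j - 1)) Z
    + c * rcov P (X (i - 1) (j - 1)) Z + rcov P (eps i j) Z.
Proof.
move=> X2 e2 Z2 ar.
have Y1 := Lfun2_addZ a (e2 i j) (X2 (i - 1) j).
have Y2 := Lfun2_addZ b Y1 (X2 i (j - 1)).
have Y3 := Lfun2_addZ c Y2 (X2 (i - 1) (j - 1)).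
rewrite (rcov_ae_eql (X2 i j) Y3 Z2).
  by rewrite !rcov_addZl //; ring.
by apply: filterS (ar i j) => w ->; ring.
Qed.

Theorem mainTheorem4 (d : measure_display) (T : measurableType d)
    (R : realType) (P : probability T R) (a b c s2 : R)
    (eps X : int -> int -> {RV P >-> R}) :
  0 < s2 ->
  white_noise s2 eps ->
  wide_sense_stationary X ->
  spatial_autoregression a b c X eps ->
  [/\ 0 < sar_disc a b c,
      forall h1 h2 : int,
        autocovariance X 0 h2 =
          (sar_beta a b c ^+ `|h2|%N * s2 / Num.sqrt (sar_disc a b c))%:E /\
        autocovariance X h1 0 =
          (sar_alpha a b c ^+ `|h1|%N * s2 / Num.sqrt (sar_disc a b c))%:E &
      forall i j : int,
        ('V_P[X i j])%E = autocovariance X 0 0 /\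
        autocovariance X 0 0 = (s2 / Num.sqrt (sar_disc a b c))%:E].
Proof.
move=> s0 [e2 _ eV eo] [X2 _ Xstat] ar.
pose r h k := rcov P (X 0 0) (X (0 - h) (0 - k)).
have stat i j k l : rcov P (X i j) (X k l) = r (i - k) (j - l).
  have [g gE] := Xstat (i - k) (j - l).
  by have := gE i j; rewrite !subKr /r /rcov => ->; rewrite gE.
have rN h k : r (- h) (- k) = r h k.
  by rewrite {2}/r rcovC stat !subr0 !sub0r.
(* Defined from [r] so that one of the two equations holds by definition; [cross] identifies it with
   the cross-covariance of field and noise. *)
pose g h k := r h k - a * r (h + 1) k - b * r h (k + 1) - c * r (h + 1) (k + 1).
have cross i j k l : rcov P (X i j) (eps k l) = g (i - k) (j - l).
  have := rcov_autoregression k l X2 e2 (X2 i j) ar.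
  rewrite rcovC (rcovC P (eps k l)) !(rcovC P (X _ _) (X i j)) !stat /g.
  rewrite !opprB !addrA -!(addrAC _ 1) => ->; ring.
have eqg h k : g h k - a * g (h - 1) k - b * g h (k - 1) - c * g (h - 1) (k - 1)
    = s2 * ((h == 0) && (k == 0))%:R.
  have := rcov_autoregression h k X2 e2 (e2 0 0) ar.
  rewrite !cross !subr0.
  have -> : rcov P (eps h k) (eps 0 0) = s2 * ((h == 0) && (k == 0))%:R.
    case: andP => [[/eqP -> /eqP ->]|ne].
      by rewrite /rcov -/(variance P (eps 0 0)) eV mulr1.
    rewrite mulr0 /rcov eo // => -[h0 k0]; apply: ne.
    by rewrite h0 k0 eqxx.
  by move=> ->; ring.
have g2 : sum_bounded (fun i j => g i j ^+ 2) (s2 * rcov P (X 0 0) (X 0 0)).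
  have bs : sum_bounded (fun i j => rcov P (X 0 0) (eps i j) ^+ 2)
      (s2 * rcov P (X 0 0) (X 0 0)).
    apply: (bessel_rcov (e := fun x : int * int => eps x.1 x.2)) => //.
    - by move=> [i j]; rewrite /rcov -/(variance P (eps i j)) eV.
    - move=> [i j] [k l] /eqP ne; rewrite /rcov eo //.
  (* Bessel's inequality fixes [X 0 0] and varies the noise, so the lattice must be reflected to
     reach [g]. *)
  have -> : (fun i j => g i j ^+ 2)
      = (fun i j => rcov P (X 0 0) (eps (- i) (- j)) ^+ 2).
    by apply/funext => i; apply/funext => j; rewrite cross !sub0r !opprK.
  apply: (sum_bounded_comp (u := fun x => (- x.1, - x.2))) bs.
  by move=> [? ?] [? ?] [/oppr_inj -> /oppr_inj ->].
have rK h k : `|r h k| <= r 0 0.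
  have := rcov_norm_le (X2 0 0) (X2 (0 - h) (0 - k)).
  by rewrite -/(r h k) !stat !subrr; lra.
have D0 := sar_disc_gt0 s0 g2 eqg.
have rows := row_closed_form s0 g2 rK rN (fun _ _ => erefl) eqg.
(* The row formula is applied to the transposed [r] and [g], with [a] and [b] swapped. *)
have cols k : r k 0 = sar_alpha a b c ^+ `|k|%N * s2 / Num.sqrt (sar_disc a b c).
  rewrite -sar_betaC -sar_discC.
  apply: (row_closed_form (r := fun h k => r k h) (g := fun h k => g k h) s0) => //.
  - apply: (sum_bounded_comp (u := fun x => (x.2, x.1))) g2.
    by move=> [? ?] [? ?] [-> ->].
  - by move=> h j; rewrite /g; ring.
  - by move=> h j; rewrite andbC -eqg; ring.
have aE h k : autocovariance X h k = (r h k)%:E by rewrite /autocovariance rcovE.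
split=> // [h1 h2|i j]; first by rewrite !aE rows cols.
split; last by rewrite aE rows absz0 expr0 mul1r.
have [v vE] := Xstat 0 0; rewrite /variance.
by have := vE i j; have := vE 0 0; rewrite /autocovariance !subr0 => -> ->.
Qed.
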